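(* Let $t\in\mathbb{C}$ with $t\neq0$ and $t^3+27\neq0$, let $F(x,y,z)=x^3+y^3+z^3+txyz$, and let $z_i\in\mathbb{C}$ be any root of $z^3+tz+2=0$. Then the osculating conic of the plane cubic curve $F=0$ at the sextactic point $P=(1:1:z_i)$ is given by the equation $O_P(x,y,z)=0$, where $$O_P(x,y,z)=z_i^2(9-6tz_i)(x^2+y^2)+z_i(15tz_i+18)(xz+yz)-z_i^2(t^2z_i^2+18)\,xy+(z_i^2t^2-18tz_i-36)\,z^2 .$$
   Context: The curve is considered in the complex projective plane $\mathbb{P}^2$ with homogeneous coordinates $x,y,z$. Let $C$ be a plane curve and $P$ a point of $C$ that is neither a singular point nor an inflection point. The osculating conic $O_P$ of $C$ at $P$ is the conic meeting $C$ at $P$ with intersection multiplicity at least $5$. The point $P$ is called sextactic if the intersection multiplicity of $C$ and $O_P$ at $P$ is at least $6$. *)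

(* Defs.v *)
From HB Require Import structures.
From mathcomp Require Import all_boot all_order all_algebra.
From mathcomp Require Import complex reals.
From mathcomp Require Import mpoly.

Set Implicit Arguments.
Unset Strict Implicit.
Unset Printing Implicit Defensive.

Import Order.TTheory GRing.Theory Num.Theory.
Local Open Scope ring_scope.

(* A plane curve is given by a ternary form, and a point of P^2 by a nonzero
   vector of homogeneous coordinates; all the predicates below are invariant
   under rescaling of either. *)

Definition hom_coord (K : fieldType) (a b c : K) : 'I_3 -> K :=
  tnth [tuple a; b; c].

Definition varX (K : fieldType) : {mpoly K[3]} := 'X_(@Ordinal 3 0 isT).
Definition varY (K : fieldType) : {mpoly K[3]} := 'X_(@Ordinal 3 1 isT).
Definition varZ (K : fieldType) : {mpoly K[3]} := 'X_(@Ordinal 3 2 isT).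

(* For forms F, G, h, with h of degree e: h lies in local_ideal F G P iff, for
   one (equivalently, every) form u of degree e with u(P) <> 0, the fraction
   h / u lies in the ideal (F, G) of the local ring of P^2 at P. *)
Definition local_ideal (K : fieldType) (F G : {mpoly K[3]}) (P : 'I_3 -> K)
    (h : {mpoly K[3]}) : Prop :=
  exists (s a b : {mpoly K[3]}) (k : nat),
    [/\ s \is k.-homog, s.@[P] != 0 & s * h = a * F + b * G].

(* The intersection multiplicity of F and G at P is the (possibly infinite)
   dimension over K of the local ring of P^2 at P modulo (F, G). It is at least
   n iff n elements of the local ring are linearly independent modulo (F, G).
   Over a common denominator u, such elements are fractions h_i / u with u and
   all h_i forms of one degree e; the choice of u is irrelevant, because two
   choices differ by a unit of the local ring, so only the h_i are recorded. *)
Definition int_mult_ge (K : fieldType) (F G : {mpoly K[3]}) (P : 'I_3 -> K)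
    (n : nat) : Prop :=
  exists (e : nat) (h : 'I_n -> {mpoly K[3]}),
    (forall i, h i \is e.-homog) /\
    (forall c : 'I_n -> K,
       local_ideal F G P (\sum_(i < n) c i *: h i) -> forall i, c i = 0).

Definition nonsingular_point (K : fieldType) (F : {mpoly K[3]})
    (P : 'I_3 -> K) : Prop :=
  [/\ exists i, P i != 0, F.@[P] = 0 & exists i, (F^`M(i)).@[P] != 0].

Definition tangent_line (K : fieldType) (F : {mpoly K[3]}) (P : 'I_3 -> K) :
    {mpoly K[3]} :=
  \sum_(i < 3) (F^`M(i)).@[P] *: 'X_i.

Definition inflection_point (K : fieldType) (F : {mpoly K[3]})
    (P : 'I_3 -> K) : Prop :=
  nonsingular_point F P /\ int_mult_ge F (tangent_line F P) P 3.

Definition is_conic (K : fieldType) (Q : {mpoly K[3]}) : Prop :=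
  Q != 0 /\ Q \is 2.-homog.

(* Q = 0 is THE osculating conic: any conic meeting the curve at P with
   multiplicity at least 5 has the same equation up to a scalar. *)
Definition osculating_conic (K : fieldType) (F : {mpoly K[3]})
    (P : 'I_3 -> K) (Q : {mpoly K[3]}) : Prop :=
  [/\ nonsingular_point F P, ~ inflection_point F P, is_conic Q,
      int_mult_ge F Q P 5
    & forall Q' : {mpoly K[3]}, is_conic Q' -> int_mult_ge F Q' P 5 ->
        exists c : K, Q' = c *: Q].

Definition sextactic_point (K : fieldType) (F : {mpoly K[3]})
    (P : 'I_3 -> K) : Prop :=
  exists Q : {mpoly K[3]}, osculating_conic F P Q /\ int_mult_ge F Q P 6.

(* Main.v *)
Require Import Defs.
From HB Require Import structures.
From mathcomp Require Import all_boot all_order all_algebra.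
From mathcomp Require Import complex reals.
From mathcomp Require Import mpoly.
From mathcomp Require Import ring.

Set Implicit Arguments.
Unset Strict Implicit.
Unset Printing Implicit Defensive.

Import Order.TTheory GRing.Theory Num.Theory.
Local Open Scope ring_scope.

(** Write w = z^3 for the root z, v = Z / z, d = X - Y, l = X + Y - 2 v and
    S = X + Y.  Since t z = - (w + 2), the cubic F and the conic O are symmetric
    of degree at most 3 in X and Y, hence affine in X Y once expressed through
    S, X Y and v.
    Two identities carry the theorem:

      4 F = l (S^2 - w S v - 2 w v^2) + d^2 u,
      u O = c F - z^2 (w - 1)^2 l^3,     where u = 3 S + (w + 2) v

    for a constant c.  The hypothesis t^3 + 27 <> 0 excludes exactly w = 1 and
    w = - 8, so 1 - w and u(P) = w + 8 do not vanish.  By the first identity, l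
    is the tangent at P, d is a uniformizer of the curve at P and l has order
    exactly 2 along the curve: P is not a flex.  By the second one, O agrees up
    to a unit with l^3 modulo F, so it meets the curve with multiplicity 6.

    To turn orders into intersection multiplicities, the curve is parametrized
    at P by polynomials g in one variable such that d pulls back to 'X, v to 1
    and F to a multiple of 'X^6.  For n <= 6 a form G then satisfies
    int_mult_ge F G P n iff 'X^n divides its pullback: the direct part is
    [pullback_int_mult_ge], the converse [int_mult_ge_pullback].  The first one
    rests on the fact that, modulo F and up to forms not vanishing at P, every
    form vanishing to order m along the branch is a multiple of d^m
    ([divide_iter]).

    Finally l pulls back to c1 'X^2 + c2 'X^4 with c1 <> 0.  A conic is a
    quadratic form in v, d, l, and comparing the coefficients of 1, 'X, .., 'X^4
    shows that the conics of contact at least 5 form a line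
    ([conic_contact5]); the nonzero conic O spans it. *)

(** * Ternary forms in local coordinates *)

(** Each monomial is charged to the first variable that occurs in it. *)
Lemma dhomog_varX_sum (n : nat) (K : comNzRingType) (e : nat) (h : {mpoly K[n]}) :
  h \is e.+1.-homog ->
  exists g : 'I_n -> {mpoly K[n]},
    (forall i, g i \is e.-homog) /\ h = \sum_(i < n) 'X_i * g i.
Proof.
move=> hh.
pose var (m : 'X_{1..n}) := [pick i | m i != 0%N].
exists (fun i => \sum_(m <- msupp h | var m == Some i) h@_m *: 'X_[m - U_(i)]).
have le_var m i : var m = Some i -> (U_(i) <= m)%MM.
  rewrite /var; case: pickP => // j mj [<-].
  by apply/mnm_lepP => k; rewrite mnm1E; case: eqP => // <-; rewrite lt0n.
split=> [i|].
  rewrite big_seq_cond; apply: rpred_sum => m /andP[mh /eqP /le_var le_im].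
  apply/dhomogZ; rewrite dhomogX /=.
  have := dhomog_mf hh mh; rewrite /= -{1}(submK le_im) mdegD mdeg1 addn1.
  by case=> ->.
rewrite {1}[h]mpolyE.
under [RHS]eq_bigr => i _ do rewrite big_mkcond mulr_sumr.
rewrite exchange_big /=; apply: eq_big_seq => m mh.
case E: (var m) => [i|]; last first.
  move: E (dhomog_mf hh mh); rewrite /var /=; case: pickP => // m0 _.
  by rewrite mdegE big1 // => i _; apply/eqP; rewrite -[_ == _]negbK m0.
rewrite (bigD1 i) //= eqxx big1 ?addr0 => [|j /negPf ji]; last first.
  by rewrite (inj_eq Some_inj) eq_sym ji mulr0.
by rewrite -scalerAr -mpolyXD addmC submK // le_var.
Qed.

Lemma dhomog0_const (n : nat) (K : nzRingType) (h : {mpoly K[n]}) :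
  h \is 0.-homog -> exists c, h = c%:MP.
Proof.
move=> h0; exists h@_0; apply/mpolyP => m; rewrite mcoeffC eq_sym.
have [->|m0] := eqVneq m 0%MM; first by rewrite mulr1.
by rewrite mulr0 (dhomog_nemf_coeff h0) //= mdeg_eq0.
Qed.

Section Coordinates.
Variables (K : fieldType) (P : 'I_3 -> K) (v l d : {mpoly K[3]}).
Hypothesis (v1 : v \is 1.-homog).
Variables al be : 'I_3 -> K.
Hypothesis XE : forall i, 'X_i = P i *: v + al i *: l + be i *: d.

(** By substitution of [XE] for one variable at a time.  The factor v gives a and b
    the degree e, which also makes sense for the constants, where e = 0. *)
Lemma form_at_point e h : h \is e.-homog ->
  exists a b, [/\ a \is e.-homog, b \is e.-homog &
    v * h = h.@[P] *: v ^+ e.+1 + a * l + b * d].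
Proof.
elim: e h => [|e IH] h he.
  exists 0, 0; split; rewrite ?dhomog0 // !mul0r !addr0 expr1.
  have [c ->] := dhomog0_const he.
  by rewrite mevalC mulrC mul_mpolyC.
have [g [ge ->]] := dhomog_varX_sum he.
have {IH}/fin_all_exists[a /fin_all_exists[b ab]] := fun i => IH (g i) (ge i).
exists (\sum_i ('X_i * a i + ((g i).@[P] * al i) *: v ^+ e.+1)),
       (\sum_i ('X_i * b i + ((g i).@[P] * be i) *: v ^+ e.+1)).
have ve : v ^+ e.+1 \is e.+1.-homog by rewrite -[X in X.-homog]mul1n dhomogMn.
have X1 i : ('X_i : {mpoly K[3]}) \is 1.-homog by rewrite dhomogX /= mdeg1.
split.
- apply: rpred_sum => i _; case: (ab i) => ? ? _.
  by apply: rpredD; [exact: dhomogM (X1 i) _|exact: dhomogZ].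
- apply: rpred_sum => i _; case: (ab i) => ? ? _.
  by apply: rpredD; [exact: dhomogM (X1 i) _|exact: dhomogZ].
rewrite raddf_sum /= scaler_suml mulr_sumr !mulr_suml -!big_split /=.
apply: eq_bigr => i _; case: (ab i) => _ _ E.
rewrite mulrCA E mevalM mevalXU !mulrDr -scalerAr {1}XE -!mul_mpolyC !mpolyCM !exprS.
by ring.
Qed.

Lemma conic_coordinates q : q \is 2.-homog -> exists a0 a1 a2 a3 a4 a5,
  q = a0 *: (v * v) + a1 *: (v * d) + a2 *: (v * l) + a3 *: (d * d)
    + a4 *: (d * l) + a5 *: (l * l).
Proof.
have lin h : h \is 1.-homog -> exists a b c, h = a *: v + b *: d + c *: l.
  move=> /dhomog_varX_sum[g [g0 ->]].
  have /fin_all_exists[c cE] : forall i, exists c, g i = c%:MP.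
    by move=> i; apply: dhomog0_const.
  exists (\sum_i c i * P i), (\sum_i c i * be i), (\sum_i c i * al i).
  rewrite !scaler_suml -!big_split; apply: eq_bigr => i _ /=.
  by rewrite cE XE -!mul_mpolyC !mpolyCM; ring.
case/dhomog_varX_sum => g [g1 ->].
have /fin_all_exists[a /fin_all_exists[b /fin_all_exists[c abc]]] :=
  fun i => lin (g i) (g1 i).
exists (\sum_i P i * a i), (\sum_i (P i * b i + be i * a i)),
  (\sum_i (P i * c i + al i * a i)), (\sum_i be i * b i),
  (\sum_i (be i * c i + al i * b i)), (\sum_i al i * c i).
rewrite !scaler_suml -!big_split; apply: eq_bigr => i _ /=.
by rewrite abc XE -!mul_mpolyC !mpolyCD !mpolyCM; ring.
Qed.
End Coordinates.

(** * Intersection multiplicity as order along a branch *)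

Lemma dvd_polyXnP (K : fieldType) n (p : {poly K}) :
  reflect (forall i, (i < n)%N -> p`_i = 0) ('X^n %| p).
Proof.
apply: (iffP idP) => [/dvdpP[q ->] i ni|p0]; first by rewrite coefMXn ni.
rewrite /dvdp -Pdiv.IdomainMonic.take_poly_modp; apply/eqP/polyP => i.
by rewrite coef_take_poly coef0; case: ifP => // /p0.
Qed.

Section Branch.
Variables (K : fieldType) (g : 'I_3 -> {poly K}).

(** The substitution of a parametrization g of a branch, with parameter 'X. *)
Definition pullback (h : {mpoly K[3]}) : {poly K} := mmap polyC g h.

Lemma pullbackD h1 h2 : pullback (h1 + h2) = pullback h1 + pullback h2.
Proof. exact: rmorphD. Qed.

Lemma pullbackM h1 h2 : pullback (h1 * h2) = pullback h1 * pullback h2.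
Proof. exact: rmorphM. Qed.

Lemma pullbackXn h n : pullback (h ^+ n) = pullback h ^+ n.
Proof. exact: rmorphXn. Qed.

Lemma pullback_sum (I : finType) (h : I -> {mpoly K[3]}) :
  pullback (\sum_i h i) = \sum_i pullback (h i).
Proof. exact: rmorph_sum. Qed.

Lemma pullbackC c : pullback c%:MP = c%:P.
Proof. exact: mmapC. Qed.

Lemma pullbackZ a h : pullback (a *: h) = a *: pullback h.
Proof. by rewrite -mul_mpolyC pullbackM pullbackC mul_polyC. Qed.

Lemma pullbackB h1 h2 : pullback (h1 - h2) = pullback h1 - pullback h2.
Proof. exact: rmorphB. Qed.

Lemma pullbackX i : pullback 'X_i = g i.
Proof. by rewrite /pullback mmapX mmap1U. Qed.

Variable P : 'I_3 -> K.
Hypothesis gP : forall i, (g i).[0] = P i.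

(** The branch passes through P at the parameter value 0. *)
Lemma pullback0 h : (pullback h).[0] = h.@[P].
Proof.
rewrite /pullback /meval /mmap horner_sum; apply: eq_bigr => m _.
rewrite hornerM hornerC; congr (_ * _).
by rewrite /mmap1 horner_prod; apply: eq_bigr => i _; rewrite horner_exp gP.
Qed.

Lemma dvdX_pullback h : ('X %| pullback h) = (h.@[P] == 0).
Proof. by rewrite -pullback0 -['X]subr0 -polyC0 dvdp_XsubCl. Qed.

(** A form not vanishing at P pulls back to a unit of the power series ring. *)
Lemma pullback_unit n s q :
  s.@[P] != 0 -> ('X^n %| pullback s * q) = ('X^n %| q).
Proof.
move=> sP; rewrite Gauss_dvdpr // coprimep_expl //.
by rewrite coprimep_sym -['X]subr0 coprimep_XsubC /root pullback0.
Qed.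

Variables (F v d : {mpoly K[3]}) (N : nat).
Hypothesis (Fg : 'X^N %| pullback F).
Hypotheses (v1 : v \is 1.-homog) (vg : pullback v = 1).
Hypotheses (d1 : d \is 1.-homog) (dg : pullback d = 'X).

(** The forms d^i v^(n-1-i) pull back to 'X^i, and every element of the local
    ideal (F, G) pulls back to a multiple of 'X^n up to a unit. *)
Lemma int_mult_ge_pullback G n :
  (n <= N)%N -> 'X^n %| pullback G -> int_mult_ge F G P n.
Proof.
move=> nN Gn; exists n.-1, (fun i : 'I_n => d ^+ i * v ^+ (n.-1 - i)).
split=> [i|c [s [a [b [k [_ sP E]]]]] i].
  have in1 : (i <= n.-1)%N by case: n i {nN Gn} => [[]|n i] //=; rewrite -ltnS.
  rewrite -[X in X.-homog](subnKC in1) dhomogM //.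
    by rewrite -[X in X.-homog]mul1n dhomogMn.
  by rewrite -[X in X.-homog]mul1n dhomogMn.
(* [insub] extends c by 0 to all natural numbers. *)
have: 'X^n %| \poly_(j < n) oapp c 0 (insub j).
  rewrite -(pullback_unit _ _ sP) poly_def.
  suff -> : pullback s * \sum_(j < n) oapp c 0 (insub (val j)) *: 'X^j =
      pullback a * pullback F + pullback b * pullback G.
    by rewrite dvdp_add // dvdp_mull // (dvdp_trans _ Fg) // dvdp_exp2l.
  rewrite -!pullbackM -pullbackD -E pullbackM pullback_sum; congr (_ * _).
  apply: eq_bigr => j _; rewrite pullbackZ pullbackM !pullbackXn vg dg.
  by rewrite expr1n mulr1 valK.
move/dvd_polyXnP/(_ i (ltn_ord i)).
by rewrite coef_poly ltn_ord valK.
Qed.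

(** The form d generates the maximal ideal of the local ring of F = 0 at P. *)
Hypothesis divide : forall e h, h \is e.-homog -> h.@[P] = 0 ->
  exists s a b k l, [/\ s \is k.-homog, b \is l.-homog, s.@[P] != 0 &
    s * h = a * F + b * d].

(** One more factor d can be extracted as long as the cofactor b vanishes at P,
    which is read off its pullback. *)
Lemma divide_iter m e h : (m <= N)%N -> h \is e.-homog -> 'X^m %| pullback h ->
  exists s a b k l, [/\ s \is k.-homog, b \is l.-homog, s.@[P] != 0 &
    s * h = a * F + b * d ^+ m].
Proof.
move=> + hh; elim: m => [|m IH] mN hm.
  exists 1, 0, h, 0%N, e; split; rewrite ?dhomog1 ?meval1 ?oner_eq0 //.
  by rewrite mul0r add0r mulr1 mul1r.
have [|s [a [b [k [l [sk bl sP E]]]]]] := IH (ltnW mN).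
  by apply: dvdp_trans hm; rewrite dvdp_exp2l.
have bP : b.@[P] = 0.
  apply/eqP; rewrite -dvdX_pullback.
  rewrite -(@dvdp_mul2r _ 'X^m) ?expf_neq0 ?polyX_eq0 // -exprS.
  have -> : pullback b * 'X^m = pullback s * pullback h - pullback a * pullback F.
    by rewrite -pullbackM E pullbackD !pullbackM pullbackXn dg addrC addKr.
  by rewrite dvdp_sub // dvdp_mull // (dvdp_trans _ Fg) // dvdp_exp2l.
have [s' [a' [b' [k' [l' [sk' bl' sP' E']]]]]] := divide bl bP.
exists (s' * s), (s' * a + d ^+ m * a'), b', (k' + k)%N, l'; split=> //.
- exact: dhomogM.
- by rewrite mevalM mulf_neq0.
by rewrite -mulrA E mulrDr mulrDl -!mulrA mulrCA !mulrA [s' * b]E' exprS; ring.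
Qed.

(** If the pullback of G has exact order m < n, then d^m lies in (F, G) up to a
    unit.  Among any n forms h_i of one degree, some nontrivial combination has
    a pullback divisible by 'X^m, since this imposes only m linear conditions;
    that combination is a multiple of d^m, hence lies in (F, G). *)
Lemma pullback_int_mult_ge G e n : (n <= N)%N -> G \is e.-homog ->
  int_mult_ge F G P n -> 'X^n %| pullback G.
Proof.
move=> nN Ge [e' [h [he hfree]]]; apply/negPn/negP => nG.
(* m is the order of the pullback of G. *)
have [m /andP[mn Gm] nGm] : exists2 m, (m < n)%N && ('X^m %| pullback G) &
    ~~ ('X^(m.+1) %| pullback G).
  elim: n nG {nN h he hfree} => [|n IH] nG; first by rewrite dvd1p in nG.
  case: (boolP ('X^n %| pullback G)) => Gn; first by exists n; rewrite ?ltnSn.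
  by have [m /andP[/ltnW mn Gm] nGm] := IH Gn; exists m; rewrite // ltnS mn.
have mN : (m < N)%N := leq_trans mn nN.
have [s [a [b [k [l [sk bl sP E]]]]]] := divide_iter (ltnW mN) Ge Gm.
have bP : b.@[P] != 0.
  apply: contra nGm => /eqP bP; rewrite -(pullback_unit _ _ sP) -pullbackM E.
  rewrite pullbackD !pullbackM pullbackXn dg dvdp_add //.
    by rewrite dvdp_mull // (dvdp_trans _ Fg) // dvdp_exp2l.
  rewrite exprS dvdp_mul //.
  by rewrite dvdX_pullback bP.
(* The coefficients of degree < m of the pullbacks. *)
pose M := \matrix_(i < n, j < m) (pullback (h i))`_j.
have : kermx M != 0.
  by rewrite -mxrank_eq0 mxrank_ker subn_eq0 -ltnNge (leq_ltn_trans (rank_leq_col _)).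
case/rowV0Pn => c /sub_kermxP cM; case/negP; apply/eqP/rowP => i; rewrite mxE.
apply: (hfree (c 0)); set H := \sum_(i < n) _.
have He : H \is e'.-homog by apply: rpred_sum => j _; apply: dhomogZ.
have HX : 'X^m %| pullback H.
  apply/dvd_polyXnP => j jm; move/rowP/(_ (Ordinal jm)): cM.
  rewrite !mxE; apply: etrans; rewrite /H pullback_sum coef_sum; apply: eq_bigr => k' _.
  by rewrite pullbackZ coefZ mxE.
have [s' [a' [b' [k' [l' [sk' bl' sP' E']]]]]] := divide_iter (ltnW mN) He HX.
exists (b * s'), (b * a' - b' * a), (b' * s), (l + k')%N; split.
- exact: dhomogM.
- by rewrite mevalM mulf_neq0.
by rewrite -mulrA E' -[b' * s * G]mulrA E; ring.
Qed.
End Branch.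

(** * The Hesse cubic at a sextactic point *)

Section Hesse.
Variables (K : fieldType) (t z : K).
Hypotheses (two : 2%:R != 0 :> K) (t27 : t ^+ 3 + 27 != 0).
Hypothesis (zE : z ^+ 3 + t * z + 2 = 0).

Local Notation w := (z ^+ 3).
Local Notation X := (varX K).
Local Notation Y := (varY K).
Local Notation Z := (varZ K).
Let P := hom_coord 1 1 z.
Let v := z^-1 *: Z.
Let d := X - Y.
Let l := X + Y - 2%:MP * v.

Definition hesse_cubic := X ^+ 3 + Y ^+ 3 + Z ^+ 3 + t *: (X * Y * Z).
Let F := hesse_cubic.

Lemma tzE : t * z = - (w + 2).
Proof. by apply/eqP; rewrite -subr_eq0 -zE; apply/eqP; ring. Qed.

Lemma z_neq0 : z != 0.
Proof. by apply: contraNneq two => z0; rewrite -zE z0 expr0n mulr0 !add0r. Qed.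

(** If w = 1 then t z = - 3 and t^3 = (t z)^3 = - 27. *)
Lemma w_neq1 : 1 - w != 0.
Proof.
apply: contraNneq t27 => /eqP; rewrite subr_eq0 => /eqP w1.
have tz : t * z = - 3 by rewrite tzE -w1; ring.
have -> : t ^+ 3 = (t * z) ^+ 3 by rewrite exprMn -w1 mulr1.
by rewrite tz; apply/eqP; ring.
Qed.

(** If w = - 8 then t z = 6 and - 8 t^3 = (t z)^3 = 216. *)
Lemma w_neqN8 : w + 8 != 0.
Proof.
apply: contraNneq t27 => /eqP; rewrite addr_eq0 => /eqP w8.
have tz : t * z = 6 by rewrite tzE w8; ring.
have : 2 ^+ 3 * (t ^+ 3 + 27) = 0.
  transitivity (- (t ^+ 3 * - 8) + 216); first by ring.
  by rewrite -w8 -exprMn tz; ring.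
by move/eqP; rewrite mulf_eq0 expf_eq0 (negPf two).
Qed.

Lemma varZE : Z = z *: v.
Proof. by rewrite scalerA divff ?scale1r ?z_neq0. Qed.

Lemma hesse_cubicE :
  F = X ^+ 3 + Y ^+ 3 + w%:MP * v ^+ 3 - (w + 2)%:MP * (X * Y * v).
Proof.
have E : t%:MP * z%:MP = - (w + 2)%:MP :> {mpoly K[3]}.
  by rewrite -mpolyCM tzE mpolyCN.
by rewrite /F /hesse_cubic varZE -!mul_mpolyC; ring: E.
Qed.

(* [u] is, up to sign, the coefficient of X Y in F as a polynomial in S, X Y
   and v. *)
Let u := 3%:MP * (X + Y) + (w + 2)%:MP * v.
Let r := (X + Y) ^+ 2 - w%:MP * (X + Y) * v - (2 * w)%:MP * v ^+ 2.

(** Substitute 4 X Y = S^2 - d^2; modulo d, the remaining cubic in S and v has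
    the root S = 2 v. *)
Lemma hesse_tangent : 4%:MP * F = l * r + d ^+ 2 * u.
Proof. by rewrite hesse_cubicE /l /r /d /u; ring. Qed.

(* The first coefficients of the power series l = c1 'X^2 + c2 'X^4 + ... solving
   l (S^2 - w S - 2 w) + 'X^2 (3 S + w + 2) = 0 with S = 2 + l: they cancel the
   terms in 'X^2 and in 'X^4. *)
Let c1 := - (w + 8) / (4 * (1 - w)).
Let c2 := - (c1 ^+ 2 * (4 - w) + 3 * c1) / (4 * (1 - w)).

Lemma four_neq0 : 4 != 0 :> K.
Proof. by rewrite -[4]/(2 * 2)%:R natrM mulf_neq0. Qed.

Lemma slope_neq0 : 4 * (1 - w) != 0.
Proof. by rewrite mulf_neq0 ?four_neq0 ?w_neq1. Qed.

Lemma c1E : 4 * (1 - w) * c1 + (w + 8) = 0.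
Proof. by rewrite mulrC divfK ?slope_neq0 // addNr. Qed.

Lemma c2E : c1 ^+ 2 * (4 - w) + 4 * (1 - w) * c2 + 3 * c1 = 0.
Proof. by rewrite [4 * _ * c2]mulrC divfK ?slope_neq0 //; ring. Qed.

Lemma c1_neq0 : c1 != 0.
Proof.
by rewrite mulf_neq0 ?oppr_eq0 ?w_neqN8 // invr_eq0 slope_neq0.
Qed.

(* The point of the branch with S = X + Y, d = 'X and v = 1. *)
Let S : {poly K} := 2%:P + c1%:P * 'X^2 + c2%:P * 'X^4.
Let g : 'I_3 -> {poly K} :=
  tnth [tuple 2^-1%:P * (S + 'X); 2^-1%:P * (S - 'X); z%:P].

Lemma branch_at0 i : (g i).[0] = P i.
Proof.
by case: i => [[|[|[|//]]] ?];
 rewrite /g /P /hom_coord !(tnth_nth 0) /=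
   ?(hornerM, hornerD, hornerN, hornerX, hornerC) ?(mulr0, subr0, addr0) ?mulVf.
Qed.

Lemma pull_v : pullback g v = 1.
Proof.
by rewrite pullbackZ pullbackX /g (tnth_nth 0) /= -mul_polyC -polyCM mulVf ?z_neq0.
Qed.

Lemma half2 : 2^-1%:P * 2 = 1 :> {poly K}.
Proof. by rewrite -(polyC_natr K 2) -polyCM mulVf. Qed.

Lemma pull_XY : pullback g (X + Y) = S.
Proof.
rewrite pullbackD !pullbackX /g !(tnth_nth 0) /=.
by ring: half2.
Qed.

Lemma pull_d : pullback g d = 'X.
Proof.
rewrite /d pullbackB !pullbackX /g !(tnth_nth 0) /=.
by ring: half2.
Qed.

Lemma pull_l : pullback g l = c1%:P * 'X^2 + c2%:P * 'X^4.
Proof.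
by rewrite /l pullbackB pullbackM pullbackC pull_XY pull_v /S; ring.
Qed.

Lemma pull_F : 'X^6 %| pullback g F.
Proof.
have four : (4%:MP : {mpoly K[3]}).@[P] != 0 by rewrite mevalC four_neq0.
rewrite -(pullback_unit branch_at0 _ _ four) -pullbackM hesse_tangent.
rewrite /r /u !(pull_l, pull_d, pull_v, pull_XY, pullbackXn, pullbackC,
  pullbackB, pullbackD, pullbackM).
set p := (X in _ %| X).
suff -> : p = ((c1%:P + c2%:P * 'X^2) ^+ 3
   + (4 - w)%:P * (2%:P * c1%:P * c2%:P + c2%:P ^+ 2 * 'X^2)
   + 3%:P * c2%:P) * 'X^6 by rewrite dvdp_mull.
set q := (X in _ = X).
transitivity (q + (4 * (1 - w) * c1 + (w + 8))%:P * 'X^2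
  + (c1 ^+ 2 * (4 - w) + 4 * (1 - w) * c2 + 3 * c1)%:P * 'X^4).
  by rewrite /p /q /S; ring.
by rewrite c1E c2E polyC0 !mul0r !addr0.
Qed.

Lemma varX_deriv (i j : 'I_3) : ('X_j : {mpoly K[3]})^`M(i) = ((j == i)%:R)%:MP.
Proof.
rewrite mderivX mnm1E; case: eqP => [->|_]; last by rewrite scale0r mpolyC0.
by rewrite scale1r -{1}[U_(i)%MM]add0m [(_ - _)%MM]addmK mpolyX0 mpolyC1.
Qed.

(** The gradient at P is (1 - w) (1, 1, - 2 / z), because t = - (w + 2) / z. *)
Lemma hesse_gradient i :
  (F^`M(i)).@[P] = tnth [tuple 1 - w; 1 - w; - 2 * (1 - w) / z] i.
Proof.
have tE : t = - (w + 2) / z by rewrite -tzE mulfK ?z_neq0.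
rewrite /F /hesse_cubic !exprS expr0 !mulr1.
rewrite !(mderivD, mderivM, mderivZ) !varX_deriv.
rewrite !(mevalD, mevalM, mevalZ, mevalC, mevalXU).
by case: i => [[|[|[|//]]] p]; rewrite /P /hom_coord !(tnth_nth 0) /=;
  rewrite tE ?(mulr1n, mulr0n, mul1r, mulr1, mul0r, mulr0, add0r, addr0);
  field; rewrite z_neq0.
Qed.

Lemma tangent_lineE : tangent_line F P = (1 - w) *: l.
Proof.
rewrite /tangent_line !big_ord_recl big_ord0 addr0 !hesse_gradient !(tnth_nth 0) /=.
have -> : lift ord0 ord0 = @Ordinal 3 1 isT by apply: val_inj.
have -> : lift ord0 (lift ord0 ord0) = @Ordinal 3 2 isT by apply: val_inj.
have -> : ord0 = @Ordinal 3 0 isT by apply: val_inj.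
by rewrite -/X -/Y -/Z /l /v -!mul_mpolyC; ring.
Qed.

Lemma hesse_nonsingular : nonsingular_point F P.
Proof.
split.
- by exists ord0; rewrite /P /hom_coord (tnth_nth 0) /= oner_eq0.
- rewrite /F /hesse_cubic !(mevalD, mevalM, mevalZ, rmorphXn, mevalXU) /=.
  by rewrite /P /hom_coord !(tnth_nth 0) /= -[RHS]zE; ring.
by exists ord0; rewrite hesse_gradient (tnth_nth 0) /= w_neq1.
Qed.

Lemma varX_homog i : ('X_i : {mpoly K[3]}) \is 1.-homog.
Proof. by rewrite dhomogX /= mdeg1. Qed.

Lemma v_homog : v \is 1.-homog. Proof. by rewrite dhomogZ ?varX_homog. Qed.
Lemma d_homog : d \is 1.-homog. Proof. by rewrite rpredB ?varX_homog. Qed.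
Lemma l_homog : l \is 1.-homog.
Proof. by rewrite /l mul_mpolyC rpredB ?rpredD ?dhomogZ ?varX_homog ?v_homog. Qed.

Lemma u_homog : u \is 1.-homog.
Proof. by rewrite /u !mul_mpolyC ?rpredD ?dhomogZ ?rpredD ?varX_homog ?v_homog. Qed.

Lemma r_homog : r \is 2.-homog.
Proof.
rewrite /r -mulrA !mul_mpolyC.
have XY1 : X + Y \is 1.-homog by rewrite rpredD ?varX_homog.
by rewrite !rpredB ?dhomogZ ?(dhomogMn 2 XY1) ?(dhomogM XY1)
  ?(dhomogMn 2 v_homog) ?v_homog.
Qed.

Let al : 'I_3 -> K := tnth [tuple 2^-1; 2^-1; 0].
Let be : 'I_3 -> K := tnth [tuple 2^-1; - 2^-1; 0].

Lemma coordE i : 'X_i = P i *: v + al i *: l + be i *: d.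
Proof.
have E : 2^-1%:MP * 2 = 1 :> {mpoly K[3]} by rewrite -(mpolyC_nat _ _ 2) -mpolyCM mulVf.
case: i => [[|[|[|//]]] p]; rewrite (bool_irrelevance p isT);
  rewrite /P /hom_coord /al /be !(tnth_nth 0) /= -!mul_mpolyC.
- by rewrite -[LHS]mul1r mpolyC1 -E -/X /l /d; ring.
- by rewrite -[LHS]mul1r mpolyC1 -E -/Y /l /d; ring.
by rewrite -/Z varZE -mul_mpolyC; ring.
Qed.

Lemma v_at : v.@[P] = 1.
Proof. by rewrite mevalZ mevalXU /P /hom_coord (tnth_nth 0) /= mulVf ?z_neq0. Qed.

(** Forms vanishing at P are combinations of l and d, and [hesse_tangent] makes l
    a multiple of d^2 modulo F, because its cofactor r takes the value 4 (1 - w)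
    at P. *)
Lemma hesse_divide e h : h \is e.-homog -> h.@[P] = 0 ->
  exists s a b k l, [/\ s \is k.-homog, b \is l.-homog, s.@[P] != 0 &
    s * h = a * F + b * d].
Proof.
move=> he hP.
have [a [b [ae be' E]]] := form_at_point v_homog coordE he.
rewrite hP scale0r add0r in E.
exists (r * v), (4%:MP * a), (r * b - u * d * a), 3%N, e.+2; split.
- exact: dhomogM r_homog v_homog.
- apply: rpredB; first exact: dhomogM r_homog be'.
  exact: dhomogM (dhomogM u_homog d_homog) ae.
- rewrite mevalM v_at mulr1 /r !(mevalB, mevalD, mevalM, rmorphXn, mevalXU, mevalC) /=.
  rewrite v_at /P /hom_coord !(tnth_nth 0) /=.
  by apply: contra slope_neq0 => /eqP H; apply/eqP; rewrite -H; ring.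
rewrite -[r * v * h]mulrA E.
have -> : 4%:MP * a * F = a * (l * r + d ^+ 2 * u) by rewrite -hesse_tangent; ring.
ring.
Qed.

Lemma hesse_int_mult G n : (n <= 6)%N -> 'X^n %| pullback g G -> int_mult_ge F G P n.
Proof.
exact: (int_mult_ge_pullback branch_at0 pull_F v_homog pull_v d_homog pull_d).
Qed.

Lemma hesse_order G e n : (n <= 6)%N -> G \is e.-homog ->
  int_mult_ge F G P n -> 'X^n %| pullback g G.
Proof.
exact: (pullback_int_mult_ge branch_at0 pull_F pull_d hesse_divide).
Qed.

(** The tangent line has order exactly 2 along the branch, since c1 <> 0. *)
Lemma hesse_not_flex : ~ inflection_point F P.
Proof.
case=> _; rewrite tangent_lineE.
have T1 : (1 - w) *: l \is 1.-homog by rewrite dhomogZ ?l_homog.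
move/(@hesse_order _ _ 3 isT T1).
rewrite pullbackZ pull_l -mul_polyC => /dvd_polyXnP/(_ 2 isT)/eqP.
rewrite coefCM coefD !coefCM !coefXn /= mulr1 mulr0 addr0.
by rewrite mulf_eq0 (negPf w_neq1) (negPf c1_neq0).
Qed.

(* The combination of the three products of even order v l, d d, l l whose
   pullback has no term in 'X^2 or 'X^4. *)
Let q0 := v * l - c1 *: (d * d) - (c2 / c1 ^+ 2) *: (l * l).

(** In terms of v v, v d, v l, d d, d l, l l, the vanishing of the coefficients of
    1, 'X and 'X^3 kills those of v v, v d and d l, and the vanishing of those of
    'X^2 and 'X^4 expresses the coefficients of d d and l l by that of v l. *)
Lemma conic_contact5 q : q \is 2.-homog -> 'X^5 %| pullback g q ->
  exists c, q = c *: q0.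
Proof.
move=> q2; have [a0 [a1 [a2 [a3 [a4 [a5 ->]]]]]] := conic_coordinates coordE q2.
rewrite !(pull_l, pull_v, pull_d, pullbackZ, pullbackM, pullbackD).
set p := (X in _ %| X).
have -> : p = a0%:P + a1%:P * 'X^1 + (a2 * c1 + a3)%:P * 'X^2 + (a4 * c1)%:P * 'X^3
   + (a2 * c2 + a5 * c1 ^+ 2)%:P * 'X^4
   + (a4%:P * c2%:P + a5%:P * (2 * c1%:P * c2%:P * 'X + c2%:P ^+ 2 * 'X^3)) * 'X^5.
  by rewrite /p -!mul_polyC; ring.
move/dvd_polyXnP=> H; have := (H 0 isT, H 1 isT, H 2 isT, H 3 isT, H 4 isT)%N.
rewrite !(coefD, coefCM, coefC, coefXn, coefMXn) /= !(mulr0, mulr1, addr0, add0r).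
case=> -[[[-> ->] e2] /eqP]; rewrite mulf_eq0 (negPf c1_neq0) orbF => /eqP-> e4.
exists a2; rewrite /q0.
have -> : a3 = - (a2 * c1) by apply/eqP; rewrite -addr_eq0 addrC e2.
have -> : a5 = - (a2 * (c2 / c1 ^+ 2)).
  apply: (mulIf (expf_neq0 2 c1_neq0)); apply/eqP; rewrite -subr_eq0 -e4.
  by rewrite mulNr -mulrA divfK ?expf_neq0 ?c1_neq0 //; apply/eqP; ring.
by rewrite -!mul_mpolyC; ring.
Qed.

Definition hesse_conic :=
  (z ^+ 2 * (9 - 6 * t * z)) *: (X ^+ 2 + Y ^+ 2)
    + (z * (15 * t * z + 18)) *: (X * Z + Y * Z)
    - (z ^+ 2 * (t ^+ 2 * z ^+ 2 + 18)) *: (X * Y)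
    + (z ^+ 2 * t ^+ 2 - 18 * t * z - 36) *: Z ^+ 2.
Let Q := hesse_conic.

(* The coefficients of O / z^2 in terms of w, when Z is replaced by z v. *)
Let A := 3 * (2 * w + 7).
Let B := - 3 * (5 * w + 4).
Let C := - (w ^+ 2 + 4 * w + 22).
Let D := w ^+ 2 + 22 * w + 4.

Lemma hesse_conicE :
  Q = (z ^+ 2)%:MP * (A%:MP * (X ^+ 2 + Y ^+ 2) + B%:MP * (X + Y) * v
    + C%:MP * X * Y + D%:MP * v ^+ 2).
Proof.
rewrite /Q /hesse_conic varZE.
have -> : z ^+ 2 * (9 - 6 * t * z) = z ^+ 2 * A by rewrite /A; ring: tzE.
have -> : z * (15 * t * z + 18) = z * B by rewrite /B; ring: tzE.
have -> : t ^+ 2 * z ^+ 2 + 18 = - C by rewrite -exprMn tzE /C; ring.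
have -> : z ^+ 2 * t ^+ 2 - 18 * t * z - 36 = D.
  by rewrite -exprMn [z * t]mulrC -mulrA tzE /D; ring.
by rewrite -!mul_mpolyC; ring.
Qed.

(** Eliminating X Y between O and F leaves a cubic form in S and v, which is a
    multiple of (S - 2 v)^3. *)
Lemma hesse_conic_cube :
  u * Q = (z ^+ 2 * (2 * A - C))%:MP * F - (z ^+ 2 * (w - 1) ^+ 2)%:MP * l ^+ 3.
Proof. by rewrite hesse_cubicE hesse_conicE /u /l /A /B /C /D; ring. Qed.

Lemma u_at : u.@[P] != 0.
Proof.
rewrite /u !(mevalD, mevalM, mevalXU, mevalC) v_at.
rewrite /P /hom_coord !(tnth_nth 0) /=.
by apply: contra w_neqN8 => /eqP H; apply/eqP; rewrite -H; ring.
Qed.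

Lemma pull_Q : 'X^6 %| pullback g Q.
Proof.
rewrite -(pullback_unit branch_at0 _ _ u_at) -pullbackM hesse_conic_cube.
rewrite pullbackB !(pull_l, pullbackXn, pullbackM).
apply: dvdp_sub; apply: dvdp_mull; first exact: pull_F.
have -> : c1%:P * 'X^2 + c2%:P * 'X^4 = (c1%:P + c2%:P * 'X^2) * 'X^2 by ring.
by rewrite exprMn -exprM dvdp_mull.
Qed.

(** The values at (1 : 0 : 0) and (1 : 1 : 0) are z^2 A and z^2 (2 A + C), and
    A + C = - (w - 1)^2. *)
Lemma Q_neq0 : Q != 0.
Proof.
apply: contraNneq w_neq1 => Q0.
have E a b : (Q.@[hom_coord a b 0]) = z ^+ 2 * (A * (a ^+ 2 + b ^+ 2) + C * a * b).
  rewrite hesse_conicE /v !(mevalD, mevalM, rmorphXn, mevalXU, mevalC, mevalZ) /=.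
  by rewrite /hom_coord !(tnth_nth 0) /=; ring.
have := (E 1 0, E 1 1); rewrite Q0 !meval0 => -[E1 E2].
have /eqP : z ^+ 2 * (1 - w) ^+ 2 = 0.
  transitivity (z ^+ 2 * (A * (1 ^+ 2 + 0 ^+ 2) + C * 1 * 0)
    - z ^+ 2 * (A * (1 ^+ 2 + 1 ^+ 2) + C * 1 * 1)); first by rewrite /A /C; ring.
  by rewrite -E1 -E2 subr0.
by rewrite mulf_eq0 !expf_eq0 /= (negPf z_neq0).
Qed.

Lemma Q_homog : Q \is 2.-homog.
Proof.
have XX i j : ('X_i * 'X_j : {mpoly K[3]}) \is 2.-homog.
  exact: dhomogM (varX_homog i) (varX_homog j).
rewrite /Q /hesse_conic.
apply: rpredD; [apply: rpredB; [apply: rpredD|]|]; apply: dhomogZ;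
  by [exact: XX | apply: rpredD; exact: XX].
Qed.

Lemma hesse_osculating : osculating_conic F P Q.
Proof.
split.
- exact: hesse_nonsingular.
- exact: hesse_not_flex.
- by split; [exact: Q_neq0|exact: Q_homog].
- by apply: hesse_int_mult => //; apply: dvdp_trans pull_Q; rewrite dvdp_exp2l.
move=> q [_ q2] /(@hesse_order _ _ 5 isT q2) /(conic_contact5 q2)[c ->].
have [k Qk] : exists k, Q = k *: q0.
  by apply: conic_contact5 Q_homog _; apply: dvdp_trans pull_Q; rewrite dvdp_exp2l.
have k0 : k != 0 by apply: contraNneq Q_neq0 => k0; rewrite Qk k0 scale0r.
by exists (c / k); rewrite Qk scalerA divfK.
Qed.

Lemma hesse_sextactic : sextactic_point F P.
Proof.
exists Q; split; first exact: hesse_osculating.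
by apply: hesse_int_mult => //; apply: pull_Q.
Qed.

End Hesse.

Theorem mainTheorem3 (R : realType) (t zi : R[i])
    (ht0 : t != 0) (ht : t ^+ 3 + 27 != 0) (hzi : zi ^+ 3 + t * zi + 2 = 0) :
  let x : {mpoly R[i][3]} := varX R[i] in
  let y : {mpoly R[i][3]} := varY R[i] in
  let z : {mpoly R[i][3]} := varZ R[i] in
  let F := x ^+ 3 + y ^+ 3 + z ^+ 3 + t *: (x * y * z) in
  let P := hom_coord 1 1 zi in
  let O_P :=
    (zi ^+ 2 * (9 - 6 * t * zi)) *: (x ^+ 2 + y ^+ 2)
    + (zi * (15 * t * zi + 18)) *: (x * z + y * z)
    - (zi ^+ 2 * (t ^+ 2 * zi ^+ 2 + 18)) *: (x * y)
    + (zi ^+ 2 * t ^+ 2 - 18 * t * zi - 36) *: z ^+ 2 in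
  sextactic_point F P /\ osculating_conic F P O_P.
Proof.
have two : 2%:R != 0 :> R[i] by rewrite pnatr_eq0.
by split; [exact: hesse_sextactic two ht hzi | exact: hesse_osculating two ht hzi].
Qed.
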